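(* Let $f(a,b,c,d,e,x,y)$ be analytic in a neighbourhood of the origin of $\mathbb{C}^7$, and for fixed $(a,b,c,d,e)$ write $F(X,Y)=f(a,b,c,d,e,X,Y)$. The following are equivalent. (i) In some neighbourhood of the origin, $f$ satisfies $$x\Big\{F(xq,y)-F(xq,yq)-(d+e)q^{-1}\big[F(xq,yq)-F(xq,yq^2)\big]+de\,q^{-2}\big[F(xq,yq^2)-F(xq,yq^3)\big]\Big\}$$ $$=y\Big\{\big[F(xq,yq)-F(x,yq)\big]-(a+b+c)\big[F(xq,yq^2)-F(x,yq^2)\big]+(ab+ac+bc)\big[F(xq,yq^3)-F(x,yq^3)\big]-abc\big[F(xq,yq^4)-F(x,yq^4)\big]\Big\}.$$ (ii) There exist functions $\mu_n=\mu_n(a,b,c,d,e)$, $n\ge0$, defined near the origin of $\mathbb{C}^5$, such that $$f=\sum_{n\ge0}\mu_n\,\psi_n^{(a,b,c;d,e)}(x,y|q).$$ This identity is meant as an identity of power series in $(x,y)$: for all $j,k\ge0$, the coefficient of $x^jy^k$ in the Taylor expansion of $f$ in $(x,y)$ equals $\mu_{j+k}$ times the coefficient of $x^jy^k$ in $\psi_{j+k}^{(a,b,c;d,e)}(x,y|q)$.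
   Context: Throughout, $0<q<1$. For $\alpha\in\mathbb{C}$, $(\alpha;q)_0=1$, $(\alpha;q)_n=\prod_{j=0}^{n-1}(1-\alpha q^j)$, $(\alpha;q)_\infty=\prod_{j\ge0}(1-\alpha q^j)$, and $(\alpha_1,\dots,\alpha_r;q)_n=\prod_i(\alpha_i;q)_n$. The $q$-binomial coefficient is $\begin{bmatrix}n\\k\end{bmatrix}=\frac{(q;q)_n}{(q;q)_k(q;q)_{n-k}}$. The polynomials $\psi_n$ are $$\psi_n^{(a,b,c;d,e)}(x,y|q)=\sum_{k=0}^n\begin{bmatrix}n\\k\end{bmatrix}\frac{(-1)^kq^{k(k-n)}(a,b,c;q)_k}{(d,e;q)_k}x^{n-k}y^k,$$ with $d,e\notin\{q^{-m}:m\ge0\}$. *)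

(* Defs.v *)
From mathcomp Require Import all_boot all_algebra.
From mathcomp Require Import reals complex.
Set Implicit Arguments. Unset Strict Implicit. Unset Printing Implicit Defensive.
Import GRing.Theory Num.Theory.
Local Open Scope ring_scope.
Local Open Scope complex_scope.

Section Defs.
Variable R : realType.
Local Notation C := R[i].

Definition qpoch (q : R) (al : C) (n : nat) : C :=
  \prod_(j < n) (1 - al * (q%:C) ^+ j).

Definition qbinom (q : R) (n k : nat) : C :=
  qpoch q q%:C n / (qpoch q q%:C k * qpoch q q%:C (n - k)).

Definition psi_coef (q : R) (a b c d e : C) (n k : nat) : C :=
  qbinom q n k * (-1) ^+ k * (q%:C) ^ ((k%:Z) * (k%:Z - n%:Z))
  * (qpoch q a k * qpoch q b k * qpoch q c k) / (qpoch q d k * qpoch q e k).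

Definition psi (q : R) (a b c d e : C) (n : nat) (x y : C) : C :=
  \sum_(k < n.+1) psi_coef q a b c d e n k * x ^+ (n - k) * y ^+ k.

Definition converges (u : nat -> C) (l : C) : Prop :=
  forall eps : R, 0 < eps -> exists N0 : nat, forall N : nat, (N0 <= N)%N ->
    `|u N - l| < eps%:C.

Definition toNat (n N : nat) (i : {ffun 'I_n -> 'I_N}) : {ffun 'I_n -> nat} :=
  [ffun t => nat_of_ord (i t)].

Definition mono (n : nat) (z : 'I_n -> C) (i : {ffun 'I_n -> nat}) : C :=
  \prod_(t < n) z t ^+ i t.

Definition box_sum (n : nat) (co : {ffun 'I_n -> nat} -> C) (z : 'I_n -> C) (N : nat) : C :=
  \sum_(i : {ffun 'I_n -> 'I_N}) co (toNat i) * mono z (toNat i).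

Definition pt7 (a b c d e x y : C) : 'I_7 -> C :=
  fun t => nth 0 [:: a; b; c; d; e; x; y] t.

Definition pt5 (a b c d e : C) : 'I_5 -> C :=
  fun t => nth 0 [:: a; b; c; d; e] t.

Definition in_disc (r : R) (z : C) : Prop := `|z| < r%:C.

(* f(a,b,c,d,e,x,y) equals, on the polydisc of radius r > 0 around the origin
   of C^7, the sum of the power series with coefficients co, the series being
   absolutely convergent on the closed polydisc of radius r.
   (This is exactly analyticity of f near 0, co being its Taylor coefficients;
   variables are indexed 0..6 = a,b,c,d,e,x,y.) *)
Definition taylor_rep7 (f : C -> C -> C -> C -> C -> C -> C -> C) (r : R)
    (co : {ffun 'I_7 -> nat} -> C) : Prop :=
  [/\ 0 < r,
      exists M : R, forall N : nat,
        \sum_(i : {ffun 'I_7 -> 'I_N}) `|co (toNat i)| * (r%:C) ^+ (\sum_(t < 7) toNat i t)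
          <= M%:C
    & forall a b c d e x y : C,
        in_disc r a -> in_disc r b -> in_disc r c -> in_disc r d -> in_disc r e ->
        in_disc r x -> in_disc r y ->
        converges (box_sum co (pt7 a b c d e x y)) (f a b c d e x y)].

Definition ext7 (i : {ffun 'I_5 -> nat}) (j k : nat) : {ffun 'I_7 -> nat} :=
  [ffun t : 'I_7 => if (t < 5)%N then i (inord t) else if (t == 5 :> nat) then j else k].

Definition xy_coef_sum (co : {ffun 'I_7 -> nat} -> C) (a b c d e : C) (j k : nat)
    (N : nat) : C :=
  \sum_(i : {ffun 'I_5 -> 'I_N}) co (ext7 (toNat i) j k) * mono (pt5 a b c d e) (toNat i).

Definition qdiff_eqn (q : R) (f : C -> C -> C -> C -> C -> C -> C -> C) : Prop :=
  exists r : R, 0 < r /\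
  forall a b c d e x y : C,
    in_disc r a -> in_disc r b -> in_disc r c -> in_disc r d -> in_disc r e ->
    in_disc r x -> in_disc r y ->
    let F := f a b c d e in
    let Q := q%:C in
    x * (F (x * Q) y - F (x * Q) (y * Q)
         - (d + e) * Q ^-1 * (F (x * Q) (y * Q) - F (x * Q) (y * Q ^+ 2))
         + d * e * Q ^- 2 * (F (x * Q) (y * Q ^+ 2) - F (x * Q) (y * Q ^+ 3)))
    = y * ((F (x * Q) (y * Q) - F x (y * Q))
           - (a + b + c) * (F (x * Q) (y * Q ^+ 2) - F x (y * Q ^+ 2))
           + (a * b + a * c + b * c) * (F (x * Q) (y * Q ^+ 3) - F x (y * Q ^+ 3))
           - a * b * c * (F (x * Q) (y * Q ^+ 4) - F x (y * Q ^+ 4))).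

(* statement (ii): f = sum_n mu_n psi_n as power series in (x,y): for all j,k
   the Taylor coefficient of x^j y^k of f (a function of (a,..,e), given by
   the convergent series xy_coef_sum) equals mu_{j+k} times the coefficient of
   x^j y^k in psi_{j+k}, which is psi_coef (j+k) k. *)
Definition psi_expansion (q : R) (co : {ffun 'I_7 -> nat} -> C) : Prop :=
  exists mu : nat -> C -> C -> C -> C -> C -> C,
  exists r : R, 0 < r /\
  forall a b c d e : C,
    in_disc r a -> in_disc r b -> in_disc r c -> in_disc r d -> in_disc r e ->
    forall j k : nat,
      converges (xy_coef_sum co a b c d e j k)
                (mu (j + k)%N a b c d e * psi_coef q a b c d e (j + k) k).

End Defs.

(* Main.v *)
(** For fixed [a, ..., e] write [F(x, y) = sum A_jk x^j y^k].  The difference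
    operator (left side minus right side) sends [x^j y^k] to
      [qop_x j k * x^(j+1) y^k - qop_y j k * x^j y^(k+1)],
    and since [qop_x j 0 = qop_y 0 k = 0] the equation amounts to the recurrence
      [qop_x j (k+1) * A_{j,k+1} = qop_y (j+1) k * A_{j+1,k}],
    which is first order along each antidiagonal [j + k = n].  The coefficients
    of [psi_n] satisfy it with [psi_coef n 0 = 1], and [qop_x j (k+1) <> 0] when
    [|d|, |e| < 1], so the solutions are exactly [A_jk = mu_{j+k} psi_coef (j+k) k]
    with [mu_n = A_{n,0}].  Grouping the double series by total degree makes the
    operator act degree by degree without boundary terms, and the vanishing of
    its coefficients follows from the one-variable identity theorem applied
    along rays [(t x, t y)]. *)
Require Import Defs.
From mathcomp Require Import all_boot all_order all_algebra.
From mathcomp Require Import boolp classical_sets reals complex.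
From mathcomp Require Import ring lra zify.
Import Order.TTheory GRing.Theory Num.Theory.
Local Open Scope ring_scope.
Local Open Scope complex_scope.
Set Implicit Arguments. Unset Strict Implicit. Unset Printing Implicit Defensive.
(** * Convergence of complex sequences *)

Section Convergence.
Variable R : realType.
Local Notation C := R[i].
Implicit Types (u v : nat -> C) (T : nat -> R).

Lemma monotone_limit T (B : R) :
  {homo T : m n / (m <= n)%N >-> m <= n} -> (forall n, T n <= B) ->
  exists2 l : R, (forall n, T n <= l) &
    forall eps, 0 < eps -> exists N0, forall n, (N0 <= n)%N -> l - eps < T n.
Proof.
move=> Tm TB; have supT : has_sup (range T).
  by split; [exists (T 0%N), 0%N|exists B => _ [n _ <-]].
exists (sup (range T)) => [n|eps e0].
  by apply: (ub_le_sup supT.2); exists n.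
have [_ [N _ <-] lN] := sup_adherent e0 supT.
by exists N => n /Tm; apply: lt_le_trans.
Qed.

(* Both [T] and [u + T] are nondecreasing and bounded, so [u = (u + T) - T] converges. *)
Lemma dominated_real_limit (u T : nat -> R) (B : R) :
  (forall m n, (m <= n)%N -> `|u n - u m| <= T n - T m) -> (forall n, T n <= B) ->
  exists l : R, forall eps, 0 < eps -> exists N0, forall n, (N0 <= n)%N ->
    `|u n - l| < eps.
Proof.
move=> uT TB.
have Tm : {homo T : m n / (m <= n)%N >-> m <= n}.
  by move=> m n /uT h; have := normr_ge0 (u n - u m); lra.
have uTm : {homo (fun n => u n + T n) : m n / (m <= n)%N >-> m <= n}.
  by move=> m n /uT; rewrite ler_norml => /andP[h1 h2]; lra.
have uTB n : u n + T n <= u 0%N - T 0%N + B + B.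
  by have := uT _ _ (leq0n n); have := TB n; rewrite ler_norml => ? /andP[h1 h2]; lra.
have [l1 le1 h1] := monotone_limit uTm uTB; have [l2 le2 h2] := monotone_limit Tm TB.
exists (l1 - l2) => eps e0.
have [N1 {}h1] := h1 _ e0; have [N2 {}h2] := h2 _ e0.
exists (maxn N1 N2) => n; rewrite geq_max => /andP[/h1 {}h1 /h2 {}h2].
by rewrite ltr_norml; apply/andP; have := le1 n; have := le2 n; split; lra.
Qed.

Lemma normr_Re_le (z : C) : (`|complex.Re z|)%:C <= `|z|.
Proof.
rewrite normc_def lecR -sqrtr_sqr ler_wsqrtr // lerDl; exact: sqr_ge0.
Qed.

Lemma normr_Im_le (z : C) : (`|complex.Im z|)%:C <= `|z|.
Proof.
rewrite normc_def lecR -sqrtr_sqr ler_wsqrtr // lerDr; exact: sqr_ge0.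
Qed.

Lemma normr_real_complex (x : R) : `|x%:C| = (`|x|)%:C.
Proof. by rewrite normc_def /= expr0n /= addr0 sqrtr_sqr. Qed.

Lemma normr_le_ReIm (z : C) : `|z| <= (`|complex.Re z| + `|complex.Im z|)%:C.
Proof.
rewrite {1}[z]complexE (le_trans (ler_normD _ _)) // normrM !normr_real_complex.
by rewrite (_ : `|'i| = 1) ?mul1r ?rmorphD //= normc_def /= expr0n expr1n add0r sqrtr1.
Qed.

(** Real and imaginary parts are bounded by the modulus, so each inherits the domination and has a
    real limit. *)
Lemma dominated_limit u T (B : R) :
  (forall m n, (m <= n)%N -> `|u n - u m| <= (T n - T m)%:C) ->
  (forall n, T n <= B) -> exists l, converges u l.
Proof.
move=> uT TB.
have [lr hr] : exists l : R, forall eps, 0 < eps -> exists N0, forall n, (N0 <= n)%N ->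
    `|complex.Re (u n) - l| < eps.
  apply: (dominated_real_limit _ TB) => m n /uT mn.
  rewrite -lecR; apply: le_trans mn; rewrite (le_trans _ (normr_Re_le _)) //.
  by case: (u n) (u m) => [? ?] [? ?].
have [li hi] : exists l : R, forall eps, 0 < eps -> exists N0, forall n, (N0 <= n)%N ->
    `|complex.Im (u n) - l| < eps.
  apply: (dominated_real_limit _ TB) => m n /uT mn.
  rewrite -lecR; apply: le_trans mn; rewrite (le_trans _ (normr_Im_le _)) //.
  by case: (u n) (u m) => [? ?] [? ?].
exists (lr +i* li) => eps e0.
have e2 : 0 < eps / 2 by rewrite divr_gt0.
have [N1 {}hr] := hr _ e2; have [N2 {}hi] := hi _ e2.
exists (maxn N1 N2) => n; rewrite geq_max => /andP[/hr {}hr /hi {}hi].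
apply: le_lt_trans (normr_le_ReIm _) _; rewrite ltcR.
case: (u n) hr hi => [x y] /= hr hi; lra.
Qed.

Lemma converges_cst (l : C) : converges (fun=> l) l.
Proof. by move=> eps e0; exists 0%N => N _; rewrite subrr normr0 ltcR. Qed.

Lemma eq_converges u v l : u =1 v -> converges u l -> converges v l.
Proof.
by move=> uv ul eps /ul[N0 h]; exists N0 => N /h; rewrite uv.
Qed.

Lemma convergesD u v l m :
  converges u l -> converges v m -> converges (fun n => u n + v n) (l + m).
Proof.
move=> ul vm eps e0; have e2 : 0 < eps / 2 by rewrite divr_gt0.
have [N1 h1] := ul _ e2; have [N2 h2] := vm _ e2.
exists (maxn N1 N2) => n; rewrite geq_max => /andP[/h1 {}h1 /h2 {}h2].
rewrite opprD addrACA (le_lt_trans (ler_normD _ _)) //.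
by rewrite [eps]splitr rmorphD /= ltrD.
Qed.

Lemma convergesMl (c : C) u l : converges u l -> converges (fun n => c * u n) (c * l).
Proof.
(* The modulus is itself a complex number; its real part [c'] allows division in [R], and [c' + 1]
   keeps the divisor positive when [c = 0]. *)
move=> ul eps e0; pose c' := complex.Re `|c|.
have c'E : `|c| = c'%:C by rewrite /c' RRe_real ?normr_real.
have c'0 : 0 <= c' by rewrite -ler0c -c'E.
have [|N0 h] := ul (eps / (c' + 1)); first by rewrite divr_gt0 ?ltr_wpDl.
exists N0 => n /h {}h; rewrite -mulrBr normrM c'E.
apply: (@le_lt_trans _ _ (c'%:C * (eps / (c' + 1))%:C)).
  by apply: ler_wpM2l; [rewrite ler0c|exact: ltW].
rewrite -rmorphM ltcR mulrA ltr_pdivrMr ?ltr_wpDl //.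
by rewrite mulrC ltr_pM2l // ltrDl.
Qed.

Lemma convergesN u l : converges u l -> converges (fun n => - u n) (- l).
Proof.
by move=> /(convergesMl (-1)); rewrite mulN1r; apply: eq_converges => n; rewrite mulN1r.
Qed.

Lemma convergesB u v l m :
  converges u l -> converges v m -> converges (fun n => u n - v n) (l - m).
Proof. by move=> ul /convergesN; apply: convergesD. Qed.

Lemma converges_sum (I : Type) (s : seq I) (P : pred I) (u : I -> nat -> C) (l : I -> C) :
  (forall i, P i -> converges (u i) (l i)) ->
  converges (fun n => \sum_(i <- s | P i) u i n) (\sum_(i <- s | P i) l i).
Proof.
move=> ul; elim: s => [|i s IH].
  by rewrite big_nil; apply: eq_converges (@converges_cst 0) => n; rewrite big_nil.
rewrite big_cons; case: ifPn => Pi.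
  by apply: eq_converges (convergesD (ul _ Pi) IH) => n; rewrite big_cons Pi.
by apply: eq_converges IH => n; rewrite big_cons (negPf Pi).
Qed.

(** Serves to replace box partial sums by partial sums grouped by total degree. *)
Lemma converges_near u v l :
  (forall eps, 0 < eps -> exists N0, forall n, (N0 <= n)%N -> `|u n - v n| <= eps%:C) ->
  converges u l -> converges v l.
Proof.
move=> uv ul eps e0; have e2 : 0 < eps / 2 by rewrite divr_gt0.
have [N1 h1] := ul _ e2; have [N2 h2] := uv _ e2.
exists (maxn N1 N2) => n; rewrite geq_max => /andP[/h1 {}h1 /h2 {}h2].
rewrite -[v n - l](subrKA (u n)) (le_lt_trans (ler_normD _ _)) // distrC.
by rewrite [eps]splitr rmorphD /= ler_ltD.
Qed.

Lemma normr_real_val (z : C) : `|z| = (complex.Re `|z|)%:C.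
Proof. by rewrite RRe_real ?normr_real. Qed.

Lemma limit_norm_le u l (B : R) N0 : converges u l ->
  (forall n, (N0 <= n)%N -> `|u n| <= B%:C) -> `|l| <= B%:C.
Proof.
rewrite normr_real_val lecR => ul uB; rewrite leNgt; apply/negP => lB.
have [N1 h] : exists N1, forall n, (N1 <= n)%N -> `|u n - l| < (complex.Re `|l| - B)%:C.
  by apply: ul; rewrite subr_gt0.
have := h _ (leq_maxr N0 N1); have := uB _ (leq_maxl N0 N1) => h1 h2.
have := le_lt_trans (ler_normB (u (maxn N0 N1) - l) (u (maxn N0 N1))) (ltr_leD h2 h1).
by rewrite addrAC subrr add0r normrN -rmorphD /= subrK -normr_real_val ltxx.
Qed.

Lemma limit_uniq u l m : converges u l -> converges u m -> l = m.
Proof.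
move=> /convergesB h /h{h} h; apply/eqP; rewrite -subr_eq0 -normr_eq0 normr_real_val.
have h0 eps : 0 < eps -> `|l - m| <= eps%:C.
  move=> e0; apply: (limit_norm_le (N0 := 0) h) => n _.
  by rewrite subrr normr0 ler0c ltW.
have: 0 <= `|l - m| by [].
rewrite normr_real_val ler0c le_eqVlt => /predU1P[<- //|n0].
have := h0 (complex.Re `|l - m| / 2).
by rewrite divr_gt0 // normr_real_val lecR => /(_ isT); lra.
Qed.
End Convergence.
(** * Sums over boxes of exponents *)

Section Boxes.
Variable R : realType.
Local Notation C := R[i].

Lemma big_box_widen (V : nmodType) (n N P : nat) (G : {ffun 'I_n.+1 -> nat} -> V) :
  (N <= P)%N ->
  \sum_(i : {ffun 'I_n.+1 -> 'I_N}) G (toNat i) =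
  \sum_(i : {ffun 'I_n.+1 -> 'I_P} | [forall t, (i t < N)%N]) G (toNat i).
Proof.
(* The side [N = 0] is separate because [inord] needs a nonempty ordinal; both sums are then empty,
   as there is at least one coordinate. *)
case: N => [|N] NP.
  rewrite !big1 // => i; last by case: (i ord0).
  by move=> /forallP /(_ ord0).
pose w (i : {ffun 'I_n.+1 -> 'I_N.+1}) : {ffun 'I_n.+1 -> 'I_P} :=
  [ffun t => widen_ord NP (i t)].
pose v (i : {ffun 'I_n.+1 -> 'I_P}) : {ffun 'I_n.+1 -> 'I_N.+1} :=
  [ffun t => inord (i t)].
rewrite (reindex_onto w v) => [|i /forallP iN]; last first.
  by apply/ffunP => t; apply/val_inj; rewrite !ffunE /= inordK ?iN.
apply: eq_big => [i|i _].
  rewrite (_ : v (w i) = i) ?eqxx ?andbT.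
    by apply/esym/forallP => t; rewrite ffunE /=.
  by apply/ffunP => t; apply/val_inj; rewrite !ffunE /= inordK.
by congr G; apply/ffunP => t; rewrite !ffunE.
Qed.

Lemma ext7_0 (i : {ffun 'I_5 -> nat}) j k (t : 'I_7) (s : 'I_5) :
  t = s :> nat -> ext7 i j k t = i s.
Proof.
by move=> ts; rewrite ffunE ts ltn_ord; congr (i _); apply/val_inj; rewrite /= inordK.
Qed.

(** Separates the exponents of [x] and [y], at indices 5 and 6, from those of the five
    parameters. *)
Lemma big_box7 (V : nmodType) (N : nat) (G : {ffun 'I_7 -> nat} -> V) :
  \sum_(i : {ffun 'I_7 -> 'I_N}) G (toNat i) =
  \sum_(j < N) \sum_(k < N) \sum_(i : {ffun 'I_5 -> 'I_N}) G (ext7 (toNat i) j k).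
Proof.
rewrite pair_big /= pair_big /=.
pose w (p : 'I_N * 'I_N * {ffun 'I_5 -> 'I_N}) : {ffun 'I_7 -> 'I_N} :=
  [ffun t : 'I_7 => if (t < 5)%N then p.2 (inord t)
    else if (t == 5 :> nat) then p.1.1 else p.1.2].
pose v (i : {ffun 'I_7 -> 'I_N}) : 'I_N * 'I_N * {ffun 'I_5 -> 'I_N} :=
  ((i (inord 5), i (inord 6)), [ffun t : 'I_5 => i (inord t)]).
rewrite (reindex w) /=; last first.
  exists v => [[[j k] i] _|i _].
    congr (_, _, _); rewrite ?ffunE /= ?inordK //=.
    apply/ffunP => t; rewrite !ffunE /= inordK; last by have := ltn_ord t; lia.
    by rewrite ltn_ord inord_val.
  apply/ffunP => t; rewrite !ffunE /=.
  case: ifP => t5; first by congr (i _); apply/val_inj; rewrite /= !inordK.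
  case: eqP => [t5'|t5']; congr (i _); apply/val_inj; rewrite /= inordK //.
  by have := ltn_ord t; lia.
apply: eq_bigr => [[[j k] i]] _; congr G; apply/ffunP => t; rewrite !ffunE.
by case: ifP => _; [rewrite ?ffunE|case: ifP].
Qed.

Lemma mono_ext7 (a b c d e x y : C) (i : {ffun 'I_5 -> nat}) j k :
  mono (pt7 a b c d e x y) (ext7 i j k) = mono (pt5 a b c d e) i * x ^+ j * y ^+ k.
Proof.
rewrite /mono 2!big_ord_recr /=; congr (_ * _ * _); rewrite ?ffunE //.
apply: eq_bigr => t _; rewrite (@ext7_0 i j k _ t) //; congr (_ ^+ _).
by case: t => [[|[|[|[|[|]]]]]].
Qed.

Lemma sum_ext7 (i : {ffun 'I_5 -> nat}) j k :
  (\sum_(t < 7) ext7 i j k t = \sum_(t < 5) i t + j + k)%N.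
Proof.
rewrite 2!big_ord_recr /=; congr (_ + _ + _)%N; rewrite ?ffunE //.
by apply: eq_bigr => t _; rewrite (@ext7_0 i j k _ t).
Qed.

Lemma mono_norm_le (n : nat) (z : 'I_n -> C) (r : R) (i : {ffun 'I_n -> nat}) :
  (forall t, `|z t| <= r%:C) -> `|mono z i| <= r%:C ^+ (\sum_(t < n) i t).
Proof.
move=> zr; rewrite /mono normr_prod -prodrXr.
by apply: ler_prod => t _; rewrite normr_ge0 normrX lerXn2r ?nnegrE // (le_trans _ (zr t)).
Qed.

Lemma pt5_norm_le (a b c d e : C) (r : R) :
  in_disc r a -> in_disc r b -> in_disc r c -> in_disc r d -> in_disc r e ->
  forall t, `|pt5 a b c d e t| <= r%:C.
Proof. by move=> ? ? ? ? ? [[|[|[|[|[|//]]]]] ?]; apply: ltW. Qed.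

Lemma sum_triangle (V : nmodType) (G : nat -> nat -> V) N :
  \sum_(j < N) \sum_(k < N | (j + k < N)%N) G j k =
  \sum_(n < N) \sum_(k < n.+1) G (n - k)%N k.
Proof.
rewrite (eq_bigr (fun j : 'I_N => \sum_(k < N - j) G j k)) => [|j _]; last first.
  rewrite (big_ord_widen N (G j)) ?leq_subr //.
  by apply: eq_bigl => k; rewrite ltn_subRL.
elim: N => [|N IH]; first by rewrite !big_ord0.
(* Each row gains one entry, at [k = N - j]; together these form the new antidiagonal
   [j + k = N]. *)
rewrite (eq_bigr (fun j : 'I_N.+1 => \sum_(k < N - j) G j k + G j (N - j)%N)) => [|j _].
  rewrite big_split big_ord_recr /= subnn big_ord0 addr0 IH [RHS]big_ord_recr /=.
  congr (_ + _); rewrite (reindex_inj rev_ord_inj); apply: eq_bigr => k _ /=.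
  by rewrite subSS subKn // -ltnS.
by rewrite subSn -1?ltnS // big_ord_recr.
Qed.
End Boxes.
(** * Identity theorem for power series in one variable *)

Section Uniqueness.
Variable R : realType.
Local Notation C := R[i].

Lemma series_terms_bounded (g : nat -> C) (l : C) :
  converges (fun N => \sum_(n < N) g n) l ->
  exists2 B : R, 0 < B & forall n, `|g n| <= B%:C.
Proof.
move=> gl; have [N0 h] := gl 1 ltr01.
(* From [N0] on, a term is the difference of two partial sums within 1 of the limit, hence the 2;
   the finite sum covers the earlier terms. *)
pose B := 2 + \sum_(m < N0) complex.Re `|g m|.
have S0 : 0 <= \sum_(m < N0) complex.Re `|g m|.
  by apply: sumr_ge0 => m _; rewrite -ler0c -normr_real_val.
exists B => [|n]; first by rewrite /B; lra.
have [N0n|nN0] := leqP N0 n; last first.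
  rewrite normr_real_val lecR /B (bigD1 (Ordinal nN0)) //=.
  have : 0 <= \sum_(i < N0 | i != Ordinal nN0) complex.Re `|g i|.
    by apply: sumr_ge0 => m _; rewrite -ler0c -normr_real_val.
  by lra.
have := h _ (leqW N0n); have := h _ N0n.
rewrite big_ord_recr /= => h1 h2.
apply: (@le_trans _ _ (1%:C + 1%:C)); last by rewrite -rmorphD lecR /B; lra.
have -> : g n = (\sum_(i < n) g i + g n - l) - (\sum_(i < n) g i - l) by ring.
by rewrite (le_trans (ler_normB _ _)) // lerD // ltW.
Qed.

(** For [t <= 1/2] one has [t^m <= 2 (t^m - t^(m+1))], so the geometric bound on the tail
    telescopes. *)
Lemma tail_norm_le (g : nat -> C) (B t : R) n N :
  0 < t -> t <= 2^-1 -> (forall m, `|g m| <= B%:C) ->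
  (forall m, (m < n)%N -> g m = 0) -> (n < N)%N ->
  `|\sum_(m < N) g m * t%:C ^+ m - g n * t%:C ^+ n|
    <= (2 * B * (t ^+ n.+1 - t ^+ N))%:C.
Proof.
move=> t0 t2 gB gn0; elim: N => // N IH; rewrite ltnS leq_eqVlt => /predU1P[<-|nN].
  rewrite big_ord_recr /= big1 => [|m _]; last by rewrite gn0 ?mul0r.
  by rewrite add0r !subrr mulr0 normr0.
have B0 : 0 <= B by have := le_trans (normr_ge0 _) (gB 0%N); rewrite ler0c.
rewrite big_ord_recr /= addrAC (le_trans (ler_normD _ _)) //.
apply: (@le_trans _ _ ((2 * B * (t ^+ n.+1 - t ^+ N))%:C + (B * t ^+ N)%:C)).
  rewrite lerD ?IH // normrM rmorphM /= ler_pM //.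
  by rewrite normrX normr_real_complex rmorphXn /= gtr0_norm.
rewrite -rmorphD lecR /= exprS.
have := mulr_ge0 B0 (exprn_ge0 N (ltW t0)) => BN.
have : 0 <= (B * t ^+ N) * (2^-1 - t) by rewrite mulr_ge0 // subr_ge0.
by rewrite !exprS; lra.
Qed.

(** Strong induction: once the lower coefficients vanish, dividing the tail bound by [t^n] leaves
    [|g n| <= 2 B t] for all small [t > 0]. Convergence at [t = 1] supplies [B]. *)
Lemma power_series_unique0 (g : nat -> C) :
  (forall t : R, 0 < t -> t <= 1 -> converges (fun N => \sum_(n < N) g n * t%:C ^+ n) 0) ->
  forall n, g n = 0.
Proof.
move=> g0.
have [|B B0 gB] := @series_terms_bounded g 0.
  apply: eq_converges (g0 1 ltr01 (lexx _)) => N.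
  by apply: eq_bigr => n _; rewrite rmorph1 expr1n mulr1.
elim/ltn_ind => n IH.
have gle t : 0 < t -> t <= 2^-1 -> complex.Re `|g n| <= 2 * B * t.
  move=> t0 t2; have t1 : t <= 1 by lra.
  have h := convergesB (g0 t t0 t1) (@converges_cst _ (g n * t%:C ^+ n)).
  have : `|0 - g n * t%:C ^+ n| <= (2 * B * t ^+ n.+1)%:C.
    apply: (limit_norm_le (N0 := n.+1) h) => N nN.
    apply: le_trans (tail_norm_le t0 t2 gB IH nN) _.
    rewrite lecR ler_pM2l ?mulr_gt0 // gerBl exprn_ge0 // ltW //.
  rewrite sub0r normrN normrM normrX normr_real_complex (gtr0_norm t0).
  rewrite normr_real_val -rmorphXn -rmorphM lecR exprS mulrA ler_pM2r ?exprn_gt0 //.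
have x0 : 0 <= complex.Re `|g n| by rewrite -ler0c -normr_real_val.
apply/eqP; rewrite -normr_eq0 normr_real_val.
move: x0; rewrite le_eqVlt => /predU1P[<- //|x0].
set x := complex.Re _ in gle x0 *.
(* The choice [t = x / (4B + 2x)] is at most [1/2] and gives [2 B t < x], contradicting [gle]. *)
have D0 : 0 < 4 * B + 2 * x by lra.
have := gle (x / (4 * B + 2 * x)); rewrite divr_gt0 // ler_pdivrMr // => /(_ isT).
have -> : x <= 2^-1 * (4 * B + 2 * x) by lra.
rewrite mulrA ler_pdivlMr // => /(_ isT) h.
have : 0 < x * (2 * B + 2 * x) by rewrite mulr_gt0 //; lra.
by lra.
Qed.
End Uniqueness.

(** * The q-difference operator on power series *)

Section QOperator.
Variables (R : realType) (q : R).
Hypotheses (q_gt0 : 0 < q) (q_lt1 : q < 1).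
Local Notation C := R[i].
Local Notation Q := (q%:C : C).

Definition qop (a b c d e : C) (F : C -> C -> C) (x y : C) : C :=
  x * (F (x * Q) y - F (x * Q) (y * Q)
       - (d + e) * Q ^-1 * (F (x * Q) (y * Q) - F (x * Q) (y * Q ^+ 2))
       + d * e * Q ^- 2 * (F (x * Q) (y * Q ^+ 2) - F (x * Q) (y * Q ^+ 3)))
  - y * ((F (x * Q) (y * Q) - F x (y * Q))
         - (a + b + c) * (F (x * Q) (y * Q ^+ 2) - F x (y * Q ^+ 2))
         + (a * b + a * c + b * c) * (F (x * Q) (y * Q ^+ 3) - F x (y * Q ^+ 3))
         - a * b * c * (F (x * Q) (y * Q ^+ 4) - F x (y * Q ^+ 4))).

Lemma Q_neq0 : Q != 0.
Proof. by rewrite -normr_gt0 normr_real_complex ltcR normr_gt0 gt_eqF. Qed.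

Lemma normr_mulQX_le (x : C) n : `|x * Q ^+ n| <= `|x|.
Proof.
rewrite normrM ler_piMr // normrX normr_real_complex gtr0_norm // exprn_ile1 //.
  by rewrite ler0c ltW.
by rewrite lecR ltW.
Qed.

(** The operator evaluates its argument at nine points [(x Q^m, y Q^n)], whose coordinates do not
    exceed [x] and [y] in modulus since [0 < q < 1]. *)
Lemma converges_qop (a b c d e : C) (Fn : nat -> C -> C -> C) (F : C -> C -> C) (x y : C) :
  (forall x' y', `|x'| <= `|x| -> `|y'| <= `|y| ->
     converges (fun n => Fn n x' y') (F x' y')) ->
  converges (fun n => qop a b c d e (Fn n) x y) (qop a b c d e F x y).
Proof.
move=> FnF.
have FX m n : converges (fun N => Fn N (x * Q ^+ m) (y * Q ^+ n)) (F (x * Q ^+ m) (y * Q ^+ n)).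
  by apply: FnF; apply: normr_mulQX_le.
have := (FX 1 0, FX 1 1, FX 1 2, FX 1 3, FX 1 4, FX 0 1, FX 0 2, FX 0 3, FX 0 4)%N.
rewrite !expr0 !mulr1 !expr1 => -[[[[[[[[h0 h1] h2] h3] h4] g1] g2] g3] g4].
apply: (convergesB (convergesMl x _) (convergesMl y _)).
  exact: (convergesD (convergesB (convergesB h0 h1) (convergesMl _ (convergesB h1 h2)))
    (convergesMl _ (convergesB h2 h3))).
exact: (convergesB (convergesD (convergesB (convergesB h1 g1)
  (convergesMl _ (convergesB h2 g2))) (convergesMl _ (convergesB h3 g3)))
  (convergesMl _ (convergesB h4 g4))).
Qed.

Lemma qop_sum (I : Type) (s : seq I) (a b c d e : C) (F : I -> C -> C -> C) (x y : C) :
  qop a b c d e (fun x y => \sum_(i <- s) F i x y) x y = \sum_(i <- s) qop a b c d e (F i) x y.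
Proof.
elim: s => [|i s IH].
  by rewrite big_nil /qop !big_nil; ring.
by rewrite big_cons -IH /qop !big_cons; ring.
Qed.

(** With [V = Q^k], the last two factors are the factored form of [1 - (d+e) V/Q + de (V/Q)^2];
    likewise [qop_y] factors the cubic [1 - (a+b+c) V + (ab+ac+bc) V^2 - abc V^3]. *)
Definition qop_x (d e : C) j k : C :=
  Q ^+ j * (1 - Q ^+ k) * (1 - d * Q ^-1 * Q ^+ k) * (1 - e * Q ^-1 * Q ^+ k).

Definition qop_y (a b c : C) j k : C :=
  (Q ^+ j - 1) * Q ^+ k * (1 - a * Q ^+ k) * (1 - b * Q ^+ k) * (1 - c * Q ^+ k).

Lemma qop_monomial (a b c d e u : C) j k (x y : C) :
  qop a b c d e (fun x y => u * x ^+ j * y ^+ k) x y =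
  qop_x d e j k * u * x ^+ j.+1 * y ^+ k - qop_y a b c j k * u * x ^+ j * y ^+ k.+1.
Proof.
rewrite /qop /qop_x /qop_y /=.
rewrite !exprMn.
rewrite [x ^+ j.+1]exprS [y ^+ k.+1]exprS.
move: (x ^+ j) (y ^+ k) (Q ^+ j) (Q ^+ k) => X Y U V.
by field; exact: Q_neq0.
Qed.

Definition homog (A : nat -> nat -> C) n (x y : C) : C :=
  \sum_(k < n.+1) A (n - k)%N k * x ^+ (n - k) * y ^+ k.

(** The coefficient of [x^(j+1) y^(k+1)] in the image: [A j k.+1] arrives through multiplication by
    [x], [A j.+1 k] through multiplication by [y]. *)
Definition qop_coef (a b c d e : C) (A : nat -> nat -> C) j k : C :=
  qop_x d e j k.+1 * A j k.+1 - qop_y a b c j.+1 k * A j.+1 k.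

Lemma qop_homog (a b c d e : C) A n (x y : C) :
  qop a b c d e (homog A n) x y =
  \sum_(k < n) qop_coef a b c d e A (n.-1 - k) k * x ^+ (n - k) * y ^+ k.+1.
Proof.
rewrite /homog qop_sum.
under eq_bigr => k _ do rewrite qop_monomial.
(* The term [k = 0] of the [x] part and the term [k = n] of the [y] part vanish; shifting the index
   of the former aligns the remaining monomials. *)
rewrite sumrB big_ord_recl big_ord_recr /=.
rewrite {1}/qop_x {2}/qop_y subnn !expr0 !subrr !(mulr0, mul0r) add0r addr0.
rewrite -sumrB; apply: eq_bigr => k _; rewrite /bump /= add1n.
have kn := ltn_ord k.
have E1 : (n - k.+1 = n.-1 - k)%N by lia.
have E2 : (n - k = (n.-1 - k).+1)%N by lia.
by rewrite E1 E2 /qop_coef; ring.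
Qed.

(** The image has degree [n + 1]; one factor [t] is split off so that the sum over [n] along a ray
    is [t] times a power series in [t]. *)
Lemma qop_homog_scale (a b c d e : C) A n (x y t : C) :
  qop a b c d e (homog A n) (t * x) (t * y) = t * (qop a b c d e (homog A n) x y * t ^+ n).
Proof.
rewrite !qop_homog mulr_suml mulr_sumr; apply: eq_bigr => k _.
have kn := ltn_ord k.
rewrite !exprMn.
have tE : t ^+ (n - k) * t ^+ k.+1 = t * t ^+ n by rewrite -exprD addnS subnK 1?ltnW // exprS.
rewrite [RHS]mulrCA -tE; ring.
Qed.

(** The identity theorem is used twice: along rays it isolates each homogeneous degree, then on
    points [(s, s t)] it isolates each monomial of that degree. *)
Lemma qop_coef_eq0 (a b c d e : C) A (r : R) : 0 < r ->
  (forall x y : C, in_disc r x -> in_disc r y ->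
     converges (fun N => \sum_(n < N) qop a b c d e (homog A n) x y) 0) ->
  forall j k, qop_coef a b c d e A j k = 0.
Proof.
move=> r0 A0.
have L0 n (x y : C) : in_disc r x -> in_disc r y -> qop a b c d e (homog A n) x y = 0.
  move=> xr yr; move: n; apply: power_series_unique0 => t t0 t1.
  have tle (z : C) : in_disc r z -> in_disc r (t%:C * z).
    apply: le_lt_trans; rewrite normrM ler_piMl // normr_real_complex lecR.
    by rewrite gtr0_norm.
  have tN0 : t%:C != 0 :> C by rewrite (inj_eq (@complexI _)) gt_eqF.
  have := convergesMl t%:C^-1 (A0 _ _ (tle _ xr) (tle _ yr)); rewrite mulr0.
  apply: eq_converges => N; rewrite mulr_sumr; apply: eq_bigr => n _.
  by rewrite qop_homog_scale mulKf.
move=> j k; pose n := (j + k).+1; pose s : C := (r / 2)%:C.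
have s0 : s != 0 by rewrite (inj_eq (@complexI _)) gt_eqF // divr_gt0.
have sr (t : R) : 0 < t -> t <= 1 -> in_disc r (s * t%:C).
  move=> t0 t1; rewrite /in_disc -rmorphM normr_real_complex ltcR gtr0_norm.
    have : 0 <= r * (1 - t) by rewrite mulr_ge0 ?subr_ge0 // ltW.
    lra.
  by rewrite mulr_gt0 // divr_gt0.
(* At [(s, s t)] the degree [n] image is [s^(n+1) t] times the polynomial in [t] with coefficients
   [g], padded by zeros to a power series. *)
pose g m := if (m < n)%N then qop_coef a b c d e A (n.-1 - m) m else 0.
suff /(_ k) : forall m, g m = 0.
  by rewrite /g ltnS leq_addl /= addnK.
apply: power_series_unique0 => t t0 t1 eps e0; exists n => N nN.
rewrite subr0 (_ : \sum_(_ < _) _ = 0) ?normr0 ?ltcR //.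
have tN0 : t%:C != 0 :> C by rewrite (inj_eq (@complexI _)) gt_eqF.
have := L0 n (s * 1%:C) (s * t%:C) (sr 1 ltr01 (lexx _)) (sr t t0 t1).
rewrite qop_homog (big_ord_widen _ (fun k : nat => qop_coef a b c d e A (n.-1 - k) k
  * (s * 1%:C) ^+ (n - k) * (s * t%:C) ^+ k.+1) nN) big_mkcond /= => h.
apply: (mulfI tN0); apply: (mulfI (expf_neq0 n.+1 s0)); rewrite !mulr0 -[RHS]h.
rewrite !mulr_sumr; apply: eq_bigr => m _.
rewrite /g; case: ifP => mn; last by rewrite mul0r !mulr0.
rewrite rmorph1 mulr1 exprMn.
have -> : s ^+ n.+1 = s ^+ (n - m) * s ^+ m.+1 by rewrite -exprD addnS subnK // ltnW.
by rewrite [t%:C ^+ m.+1]exprS; ring.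
Qed.

(** * The coefficients of [psi_n] and their recurrence *)

Lemma qpochS (al : C) n : qpoch q al n.+1 = qpoch q al n * (1 - al * Q ^+ n).
Proof. by rewrite /qpoch big_ord_recr. Qed.

Lemma qpoch_neq0 (al : C) n : `|al| < 1 -> qpoch q al n != 0.
Proof.
move=> al1; apply/prodf_neq0 => j _; rewrite subr_eq0; apply/eqP => h.
have := le_lt_trans (normr_mulQX_le al j) al1.
by rewrite -h normr1 ltxx.
Qed.

(** For [n = j + k] the exponent [k (k - n)] is [- k j], which turns the integer power into the
    inverse of a natural one. *)
Lemma psi_coef_addn (a b c d e : C) j k :
  psi_coef q a b c d e (j + k) k =
  qpoch q Q (j + k) / (qpoch q Q k * qpoch q Q j) * (-1) ^+ k / Q ^+ (k * j)
  * (qpoch q a k * qpoch q b k * qpoch q c k) / (qpoch q d k * qpoch q e k).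
Proof.
rewrite /psi_coef /qbinom addnK; congr (_ * _ * _ / _).
by rewrite PoszD opprD addrCA subrr addr0 mulrN -PoszM -exprnN.
Qed.

Lemma psi_coef_0 (a b c d e : C) n : psi_coef q a b c d e n 0 = 1.
Proof.
rewrite -[in LHS](addn0 n) psi_coef_addn mul0n addn0 /qpoch !big_ord0 !expr0 !mul1r !divr1.
rewrite -/(qpoch q Q n) divff ?mulr1 //.
by apply: qpoch_neq0; rewrite normr_real_complex ltcR gtr0_norm.
Qed.

(** Between the two indices each q-shifted factorial in [a], ..., [e] changes by one factor, which
    [qop_x] or [qop_y] supplies; the powers of [Q] and the sign account for the rest. *)
Lemma psi_coef_rec (a b c d e : C) j k : `|d| < 1 -> `|e| < 1 ->
  qop_x d e j k.+1 * psi_coef q a b c d e (j + k.+1) k.+1 =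
  qop_y a b c j.+1 k * psi_coef q a b c d e (j.+1 + k) k.
Proof.
move=> d1 e1.
have Q1 : `|Q| < 1 by rewrite normr_real_complex ltcR gtr0_norm.
have := (qpoch_neq0 k.+1 d1, qpoch_neq0 k.+1 e1, qpoch_neq0 k.+1 Q1, qpoch_neq0 j.+1 Q1).
have QjN := expf_neq0 j Q_neq0; have QkN := expf_neq0 k Q_neq0.
have ZN := expf_neq0 (k * j) Q_neq0.
rewrite !psi_coef_addn /qop_x /qop_y addnS addSn.
rewrite mulSn mulnS !exprD !qpochS !mulf_eq0 !negb_or.
move=> [[[/andP[D0 D1] /andP[E0 E1]] /andP[K0 K1]] /andP[J0 J1]].
have E : (1 - d * Q^-1 * Q ^+ k.+1 = 1 - d * Q ^+ k) *
         (1 - e * Q^-1 * Q ^+ k.+1 = 1 - e * Q ^+ k).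
  by rewrite !exprS !mulrA !mulfVK ?Q_neq0.
rewrite !E !exprS.
move: (qpoch q Q (j + k)) (qpoch q Q k) (qpoch q Q j) (qpoch q d k) (qpoch q e k)
  K0 J0 D0 E0 => P1 P2 P3 P4 P5 *.
move: (Q ^+ (j + k)) => W.
by field; do ![apply/andP; split].
Qed.

(** Induction on [k] for all [j] at once, since one step along the antidiagonal goes from [(j+1, k)]
    to [(j, k+1)]. *)
Lemma psi_coef_unique (a b c d e : C) (A : nat -> nat -> C) : `|d| < 1 -> `|e| < 1 ->
  (forall j k, qop_coef a b c d e A j k = 0) ->
  forall k j, A j k = A (j + k)%N 0%N * psi_coef q a b c d e (j + k) k.
Proof.
move=> d1 e1 A0; elim=> [|k IH] j.
  by rewrite addn0 psi_coef_0 mulr1.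
have xN0 : qop_x d e j k.+1 != 0.
  have Q1 : `|Q| < 1 by rewrite normr_real_complex ltcR gtr0_norm.
  have := (qpoch_neq0 k.+1 d1, qpoch_neq0 k.+1 e1, qpoch_neq0 k.+1 Q1).
  rewrite !qpochS !mulf_eq0 !negb_or => -[[/andP[_ ?] /andP[_ ?]] /andP[_ ?]].
  rewrite /qop_x exprS !mulrA !mulfVK ?Q_neq0 //.
  by rewrite expf_neq0 ?Q_neq0 //=; do ![apply/andP; split].
apply: (mulfI xN0); rewrite mulrCA psi_coef_rec // addnS -addSn.
have /eqP := A0 j k; rewrite subr_eq0 => /eqP ->.
by rewrite IH mulrCA.
Qed.

End QOperator.

(** * Expansion in powers of the last two variables *)

Section Slices.
Variable R : realType.
Local Notation C := R[i].

Lemma big_square_widen (V : nmodType) (G : nat -> nat -> V) (m n : nat) : (m <= n)%N ->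
  \sum_(j < m) \sum_(k < m) G j k =
  \sum_(j < n) \sum_(k < n) (if (j < m)%N && (k < m)%N then G j k else 0).
Proof.
move=> mn; rewrite (big_ord_widen n (fun j : nat => \sum_(k < m) G j k)) // big_mkcond /=.
apply: eq_bigr => j _; case: ifP => jm /=; last by rewrite big1.
by rewrite (big_ord_widen n (G j)) // big_mkcond.
Qed.

Lemma sum_homog (A : nat -> nat -> C) N (x y : C) :
  \sum_(n < N) homog A n x y =
  \sum_(j < N) \sum_(k < N | (j + k < N)%N) A j k * x ^+ j * y ^+ k.
Proof. by rewrite (sum_triangle (fun j k => A j k * x ^+ j * y ^+ k)). Qed.

Section DominatedSlices.
(** [S j k n] models the [n]-th partial sum of the coefficient of [x^j y^k], and [T j k n] the sum
    of absolute values majorizing it, weighted by powers of [r]. *)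
Variables (S : nat -> nat -> nat -> C) (T : nat -> nat -> nat -> R) (r M : R).
Hypothesis r_gt0 : 0 < r.
Hypothesis STB : forall j k m n, (m <= n)%N ->
  `|S j k n - S j k m| * r%:C ^+ (j + k) <= (T j k n - T j k m)%:C.
Hypothesis ST : forall j k n, `|S j k n| * r%:C ^+ (j + k) <= (T j k n)%:C.
Hypothesis TM : forall N, \sum_(j < N) \sum_(k < N) T j k N <= M.

Let T_ge0 j k n : 0 <= T j k n.
Proof.
rewrite -ler0c; apply: le_trans (ST j k n).
by rewrite mulr_ge0 // exprn_ge0 // ler0c ltW.
Qed.

Let T_homo j k m n : (m <= n)%N -> T j k m <= T j k n.
Proof.
move=> mn; rewrite -subr_ge0 -ler0c; apply: le_trans (STB j k mn).
by rewrite mulr_ge0 // exprn_ge0 // ler0c ltW.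
Qed.

Let V N := \sum_(j < N) \sum_(k < N) T j k N.

(* Every error term below is bounded by a gap of the bounded monotone sequence [V]. *)
Let V_gap (w : nat -> nat -> R) h N P : (h <= N)%N -> (N <= P)%N ->
  (forall j k, w j k + (if (j < h)%N && (k < h)%N then T j k h else 0) <= T j k P) ->
  \sum_(j < N) \sum_(k < N) w j k <= V P - V h.
Proof.
move=> hN NP wT; rewrite lerBrDr {1}/V (big_square_widen (fun j k => T j k h) hN).
rewrite -big_split /=; apply: (@le_trans _ _ (\sum_(j < N) \sum_(k < N) T j k P)).
  by apply: ler_sum => j _; rewrite -big_split /=; apply: ler_sum => k _; apply: wT.
rewrite (big_square_widen (fun j k => T j k P) NP).
by apply: ler_sum => j _; apply: ler_sum => k _; case: ifP.
Qed.

Let V_homo : {homo V : m n / (m <= n)%N >-> m <= n}.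
Proof.
move=> m n mn; rewrite -subr_ge0; apply: le_trans (V_gap (w := fun _ _ => 0) (leqnn m) mn _).
  by rewrite big1 // => j _; rewrite big1.
by move=> j k; rewrite add0r; case: ifP => _; [exact: T_homo|].
Qed.

Let slice_limit j k : exists l, converges (S j k) l.
Proof.
have rjk : 0 < r ^+ (j + k) by rewrite exprn_gt0.
apply: (@dominated_limit _ (S j k) (fun n => T j k n / r ^+ (j + k)) (M / r ^+ (j + k))).
  move=> m n /(STB j k) h; rewrite -mulrBl -[X in X <= _](mulfK (x := r%:C ^+ (j + k))).
    by rewrite rmorphM fmorphV rmorphXn /= ler_pM2r // invr_gt0 -rmorphXn ltcR.
  by rewrite -rmorphXn (inj_eq (@complexI _)) gt_eqF.
move=> n; rewrite ler_pM2r ?invr_gt0 //.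
(* Enlarging [n] by [(j + k).+1] places [(j, k)] inside the box, so that [TM] bounds this single
   term. *)
apply: le_trans (T_homo j k (leq_addl (j + k).+1 n)) _.
have jN : (j < (j + k).+1 + n)%N by lia.
have kN : (k < (j + k).+1 + n)%N by lia.
apply: le_trans (TM ((j + k).+1 + n)).
rewrite (bigD1 (Ordinal jN)) //= (bigD1 (Ordinal kN)) //= -addrA lerDl.
by rewrite addr_ge0 ?sumr_ge0 // => i _; rewrite sumr_ge0.
Qed.

Lemma slice_expansion : exists A : nat -> nat -> C,
  (forall j k, converges (S j k) (A j k)) /\
  forall x y l : C, `|x| <= r%:C -> `|y| <= r%:C ->
    converges (fun N => \sum_(j < N) \sum_(k < N) S j k N * x ^+ j * y ^+ k) l ->
    converges (fun N => \sum_(n < N) homog A n x y) l.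
Proof.
have /boolp.choice[A SA] : forall j, exists Aj : nat -> C, forall k, converges (S j k) (Aj k).
  by move=> j; have [Aj h] := boolp.choice (slice_limit j); exists Aj.
exists A; split=> // x y l xr yr; apply: converges_near => eps e0.
have [v Vv /(_ _ e0)[N0 hV]] := monotone_limit V_homo TM.
(* The box of side [N0] lies inside the triangle [j + k < N] as soon as [2 N0 <= N]. *)
exists (N0 + N0)%N => N N0N; have N0N' : (N0 <= N)%N by lia.
(* With [N] fixed, the limit coefficients are approximated by the partial sums at level [P >= N];
   the bound obtained is uniform in [P]. *)
have hA : converges (fun P => \sum_(n < N) homog (fun j k => S j k P) n x y)
                    (\sum_(n < N) homog A n x y).
  apply: converges_sum => n _; apply: converges_sum => k _.
  rewrite -[A _ _ * _ * _]mulrA [A _ _ * _]mulrC.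
  by apply: eq_converges (convergesMl _ (SA (n - k)%N k)) => P /=; ring.
apply: (limit_norm_le (N0 := N) (convergesB (converges_cst _) hA)) => P NP.
(* Inside the triangle the error is the change from level [N] to level [P]; outside it, the whole
   box term. *)
pose w j k := if (j + k < N)%N then T j k P - T j k N else T j k N.
apply: (@le_trans _ _ (\sum_(j < N) \sum_(k < N) w j k)%:C); last first.
  rewrite lecR; apply: le_trans (V_gap (w := w) N0N' NP _) _.
    move=> j k; rewrite /w; have := T_homo j k NP; have := T_homo j k N0N'.
    have := T_ge0 j k N0; case: ifP => ?; case: ifP => ? *; lra || lia.
  by have := Vv P; have := hV _ (leqnn N0); lra.
rewrite sum_homog -sumrB rmorph_sum; apply: le_trans (ler_norm_sum _ _ _) _.
apply: ler_sum => j _; rewrite [X in _ - X]big_mkcond -sumrB rmorph_sum.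
apply: le_trans (ler_norm_sum _ _ _) _; apply: ler_sum => k _ /=.
apply: (@le_trans _ _ (`|S j k N - (if (j + k < N)%N then S j k P else 0)| * r%:C ^+ (j + k))).
  rewrite (_ : _ - _ = (S j k N - (if (j + k < N)%N then S j k P else 0)) * (x ^+ j * y ^+ k)).
    rewrite normrM ler_wpM2l // normrM !normrX exprD.
    have rc0 : (0 : C) <= r%:C by rewrite ler0c ltW.
    by apply: ler_pM; rewrite ?exprn_ge0 //; apply: lerXn2r; rewrite ?nnegrE.
  by case: ifP => _; ring.
by rewrite /w; case: ifP => _; [rewrite distrC; apply: STB|rewrite subr0; apply: ST].
Qed.

End DominatedSlices.

(** Both differences run over the indices of the large box outside the small one, where the triangle
    inequality applies. *)
Lemma box_diff_norm_le n (s : {ffun 'I_n.+1 -> nat} -> C) (t : {ffun 'I_n.+1 -> nat} -> R)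
    (w : C) N P : 0 <= w -> (N <= P)%N -> (forall i, `|s i| * w <= (t i)%:C) ->
  `|\sum_(i : {ffun 'I_n.+1 -> 'I_P}) s (toNat i)
    - \sum_(i : {ffun 'I_n.+1 -> 'I_N}) s (toNat i)| * w
  <= (\sum_(i : {ffun 'I_n.+1 -> 'I_P}) t (toNat i)
      - \sum_(i : {ffun 'I_n.+1 -> 'I_N}) t (toNat i))%:C.
Proof.
move=> w0 NP st; rewrite !(big_box_widen _ NP).
pose small (i : {ffun 'I_n.+1 -> 'I_P}) := [forall u, (i u < N)%N].
rewrite (bigID small) /= addrAC subrr add0r.
rewrite [in leRHS](bigID small) /= addrAC subrr add0r.
rewrite rmorph_sum; apply: (le_trans (ler_wpM2r w0 (ler_norm_sum _ _ _))).
by rewrite mulr_suml; apply: ler_sum => i _; apply: st.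
Qed.

Lemma box_norm_le n (s : {ffun 'I_n -> nat} -> C) (t : {ffun 'I_n -> nat} -> R)
    (w : C) N : 0 <= w -> (forall i, `|s i| * w <= (t i)%:C) ->
  `|\sum_(i : {ffun 'I_n -> 'I_N}) s (toNat i)| * w
  <= (\sum_(i : {ffun 'I_n -> 'I_N}) t (toNat i))%:C.
Proof.
move=> w0 st; rewrite rmorph_sum; apply: (le_trans (ler_wpM2r w0 (ler_norm_sum _ _ _))).
by rewrite mulr_suml; apply: ler_sum => i _; apply: st.
Qed.

Lemma taylor_rep7_expansion (f : C -> C -> C -> C -> C -> C -> C -> C) (r : R)
    (co : {ffun 'I_7 -> nat} -> C) (a b c d e : C) :
  taylor_rep7 f r co ->
  in_disc r a -> in_disc r b -> in_disc r c -> in_disc r d -> in_disc r e ->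
  exists A : nat -> nat -> C,
    (forall j k, converges (xy_coef_sum co a b c d e j k) (A j k)) /\
    forall x y : C, in_disc r x -> in_disc r y ->
      converges (fun N => \sum_(n < N) homog A n x y) (f a b c d e x y).
Proof.
move=> [r0 [M coM] cof] ar br cr dr er.
pose s j k i := co (ext7 i j k) * mono (pt5 a b c d e) i.
(* The weight is [r] to the total degree in all seven variables, so the sum of [t] over a full box
   is the one bounded by [M]. *)
pose t j k i := complex.Re `|co (ext7 i j k)| * r ^+ (\sum_(u < 5) i u + j + k)%N.
have w0 j k : 0 <= r%:C ^+ (j + k) by rewrite exprn_ge0 // ler0c ltW.
have st j k i : `|s j k i| * r%:C ^+ (j + k) <= (t j k i)%:C.
  rewrite normrM rmorphM /= -normr_real_val rmorphXn -addnA (exprD _ (\sum_(u < 5) i u)) mulrA /=.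
  by rewrite ler_wpM2r // ler_wpM2l // mono_norm_le //; apply: pt5_norm_le.
pose T j k N := \sum_(i : {ffun 'I_5 -> 'I_N}) t j k (toNat i).
have [|||A [SA fA]] := @slice_expansion (xy_coef_sum co a b c d e) T r M r0.
- by move=> j k m n mn; apply: (box_diff_norm_le (s := s j k)).
- by move=> j k n; apply: (box_norm_le (s := s j k)).
- move=> N; rewrite -lecR; apply: le_trans (coM N).
  rewrite (big_box7 N (fun i : {ffun 'I_7 -> nat} => `|co i| * r%:C ^+ (\sum_(u < 7) i u))).

  rewrite rmorph_sum ler_sum // => j _; rewrite rmorph_sum ler_sum // => k _.
  rewrite rmorph_sum ler_sum // => i _.
  by rewrite rmorphM /= -normr_real_val rmorphXn sum_ext7.
exists A; split=> // x y xr yr; apply: fA; [exact: ltW|exact: ltW|].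
apply: eq_converges (cof _ _ _ _ _ _ _ ar br cr dr er xr yr) => N.
rewrite /box_sum (big_box7 N (fun i => co i * mono (pt7 a b c d e x y) i)).
apply: eq_bigr => j _; apply: eq_bigr => k _.
rewrite /xy_coef_sum !mulr_suml; apply: eq_bigr => i _.
by rewrite mono_ext7 !mulrA.
Qed.

End Slices.

(** * Equivalence of the q-difference equation and the expansion *)

Lemma in_discW (R : realType) (r s : R) (z : R[i]) : r <= s -> in_disc r z -> in_disc s z.
Proof. by move=> rs /lt_le_trans; apply; rewrite lecR. Qed.

Theorem theorem1 (R : realType) (q : R) (hq0 : 0 < q) (hq1 : q < 1)
    (f : R[i] -> R[i] -> R[i] -> R[i] -> R[i] -> R[i] -> R[i] -> R[i])
    (r : R) (co : {ffun 'I_7 -> nat} -> R[i])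
    (hf : taylor_rep7 f r co) :
  qdiff_eqn q f <-> psi_expansion q co.
Proof.
have r0 : 0 < r by case: hf.
have qop_cvg a b c d e A (x y : R[i]) :
    (forall x y, in_disc r x -> in_disc r y ->
      converges (fun N => \sum_(n < N) homog A n x y) (f a b c d e x y)) ->
    in_disc r x -> in_disc r y ->
    converges (fun N => \sum_(n < N) qop q a b c d e (homog A n) x y)
              (qop q a b c d e (f a b c d e) x y).
  move=> fA xr yr.
  have := @converges_qop _ _ hq0 hq1 a b c d e (fun N x y => \sum_(n < N) homog A n x y)
    (f a b c d e) x y.
  have {}fA x' y' : `|x'| <= `|x| -> `|y'| <= `|y| ->
      converges (fun N => \sum_(n < N) homog A n x' y') (f a b c d e x' y').
    by move=> xx yy; apply: fA; [apply: le_lt_trans xr|apply: le_lt_trans yr].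
  by move=> /(_ fA); apply: eq_converges => N; rewrite qop_sum.
(* The radius [r2] lies below [r] for the Taylor series, below [r1] for the assumed statement, and
   below 1 to give [|d|, |e| < 1]. *)
split=> [[r1 [r10 feq]]|[mu [r1 [r10 fmu]]]];
  pose r2 := Num.min r (Num.min r1 1);
  have r20 : 0 < r2 by [rewrite !lt_min r0 r10 ltr01];
  have r2r : r2 <= r by [rewrite !ge_min lexx];
  have r2r1 : r2 <= r1 by [rewrite !ge_min lexx orbT];
  have r21 : r2 <= 1 by [rewrite !ge_min lexx !orbT];
  have lt1 (z : R[i]) : in_disc r2 z -> `|z| < 1
    by [move=> /(in_discW r21); rewrite /in_disc rmorph1].
(* [mu n] is the Taylor coefficient of [x^n], with default value 0 at parameters where its series
   has no limit. *)
- pose mu n a b c d e := xget 0 [set z | converges (xy_coef_sum co a b c d e n 0) z]%classic.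
  exists mu, r2; split=> // a b c d e ar br cr dr er j k.
  have [A [SA fA]] := taylor_rep7_expansion hf (in_discW r2r ar) (in_discW r2r br)
    (in_discW r2r cr) (in_discW r2r dr) (in_discW r2r er).
  have muA n : mu n a b c d e = A n 0%N.
    apply: limit_uniq (SA n 0%N).
    exact: (@xgetPex _ 0 [set z | converges (xy_coef_sum co a b c d e n 0) z]%classic
      (ex_intro _ _ (SA n 0%N))).
  rewrite muA -(psi_coef_unique hq0 hq1 (a := a) (b := b) (c := c) (A := A)
    (lt1 _ dr) (lt1 _ er)) //.
  apply: (qop_coef_eq0 hq0 hq1 r20) => x y xr yr.
  have := qop_cvg a b c d e A x y fA (in_discW r2r xr) (in_discW r2r yr).
  have := feq _ _ _ _ _ _ _ (in_discW r2r1 ar) (in_discW r2r1 br) (in_discW r2r1 cr)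
    (in_discW r2r1 dr) (in_discW r2r1 er) (in_discW r2r1 xr) (in_discW r2r1 yr).
  by move=> /= /eqP; rewrite -subr_eq0 => /eqP E; rewrite [in X in converges _ X]/qop E.
- exists r2; split=> // a b c d e x y ar br cr dr er xr yr /=.
  have [A [SA fA]] := taylor_rep7_expansion hf (in_discW r2r ar) (in_discW r2r br)
    (in_discW r2r cr) (in_discW r2r dr) (in_discW r2r er).
  have AE j k : A j k = mu (j + k)%N a b c d e * psi_coef q a b c d e (j + k) k.
    apply: limit_uniq (SA j k) _.
    exact: fmu (in_discW r2r1 ar) (in_discW r2r1 br) (in_discW r2r1 cr)
      (in_discW r2r1 dr) (in_discW r2r1 er) j k.
  have A0 j k : qop_coef q a b c d e A j k = 0.
    rewrite /qop_coef !AE mulrCA psi_coef_rec ?lt1 // [X in _ - X]mulrCA.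
    by rewrite addnS addSn subrr.
  (* The difference of the two sides is the limit of the operator applied to the partial sums of
     [f], all of which it annihilates by [A0]. *)
  apply/eqP; rewrite -subr_eq0; apply/eqP.
  rewrite -[LHS]/(qop q a b c d e (f a b c d e) x y); apply/esym/limit_uniq.
    exact: (@converges_cst R 0).
  apply: eq_converges (qop_cvg a b c d e A x y fA (in_discW r2r xr) (in_discW r2r yr)) => N.
  by rewrite big1 // => n _; rewrite qop_homog // big1 // => k _; rewrite A0 !mul0r.
Qed.
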